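(* Let $\lambda_1,\lambda_2,\mu_1,\mu_2$ be indeterminates and let $n,m$ be non-negative integers. Then the following identity holds in the polynomial ring $\mathscr{A}[\lambda_1,\lambda_2,\mu_1,\mu_2]$: \[ \sum_{\substack{r_1+r_2=n\\ k_1+k_2=m}}(-1)^{r_2+k_2}\lambda_1^{r_1}\lambda_2^{r_2}\mu_1^{k_1}\mu_2^{k_2} \sum_{\substack{\boldsymbol{\alpha}\in S_{r_1,k_1}^{\mathrm{sgn}}\\ \boldsymbol{\beta}\in S_{r_2,k_2}^{\mathrm{sgn}}}}\mathrm{sgn}(\boldsymbol{\beta})\, \zeta_{\mathscr{A}}(\boldsymbol{\alpha},\boldsymbol{\beta}) +\sum_{\substack{r_1+r_2=n \\ k_1+k_2=m}}(\lambda_1^{r_1}\mu_1^{k_1}+\lambda_2^{r_1}\mu_2^{k_1})(\lambda_1+\lambda_2)^{r_2}(\mu_1+\mu_2)^{k_2} \sum_{\substack{\boldsymbol{\alpha}\in S_{r_1,k_1}^{\mathrm{sgn}}\\ \boldsymbol{\beta}\in S_{r_2,k_2}^{\mathrm{sgn}}}}\zeta_{\mathscr{A}}(\boldsymbol{\alpha},\boldsymbol{\beta})=0, \] where $r_1,r_2,k_1,k_2$ range over non-negative integers and $(\boldsymbol{\alpha},\boldsymbol{\beta})$ denotes the concatenated index.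
   Context: Let $\mathscr{A}:=\left(\prod_{p \text{ prime}}\mathbb{Z}/p\mathbb{Z}\right)\big/\left(\bigoplus_{p\text{ prime}}\mathbb{Z}/p\mathbb{Z}\right)$, a $\mathbb{Q}$-algebra; $0$ denotes its zero element. Let $\mathbb{N}=\{1,2,3,\dots\}$ and $\mathbb{D}:=\mathbb{Z}\setminus\{0\}$; for $n\in\mathbb{N}$ write $\overline{n}:=-n$. For $a\in\mathbb{D}$, $\mathrm{sgn}(a)=1$ if $a>0$ and $-1$ if $a<0$, and $|a|$ is the absolute value. An index is a tuple $\boldsymbol{\alpha}=(\alpha_1,\dots,\alpha_r)\in\mathbb{D}^r$; its weight is $|\boldsymbol{\alpha}|=|\alpha_1|+\cdots+|\alpha_r|$, its depth is $r$, and $\mathrm{sgn}(\boldsymbol{\alpha}):=\prod_{i=1}^r\mathrm{sgn}(\alpha_i)$. The finite alternating multiple zeta value is \[ \zeta_{\mathscr{A}}(\alpha_1,\dots,\alpha_r):=\left(\sum_{0<m_1<\cdots<m_r<p}\frac{\mathrm{sgn}(\alpha_1)^{m_1}\cdots\mathrm{sgn}(\alpha_r)^{m_r}}{m_1^{|\alpha_1|}\cdots m_r^{|\alpha_r|}} \bmod p\right)_p\in\mathscr{A}. \] For non-negative integers $i,j$, $S_{i,j}^{\mathrm{sgn}}:=\{\boldsymbol{\alpha}\in\mathbb{D}^{i+1}\mid |\boldsymbol{\alpha}|=i+j+1\}$. *)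

(* Defs.v *)
From HB Require Import structures.
From mathcomp Require Import all_boot all_order all_algebra finmap.
From mathcomp Require Import boolp classical_sets functions cardinality fsbigop.
From mathcomp Require Import mpoly.

Set Implicit Arguments.
Unset Strict Implicit.
Unset Printing Implicit Defensive.

Import Order.TTheory GRing.Theory Num.Theory.
Local Open Scope ring_scope.
Local Open Scope quotient_scope.
Local Open Scope classical_set_scope.

Definition primeT : Type := {p : nat | prime p}.

Definition prodFp : Type := forall p : primeT, 'F_(sval p).

HB.instance Definition _ := gen_eqMixin prodFp.
HB.instance Definition _ := gen_choiceMixin prodFp.

Section ProdFpRing.

Let add (f g : prodFp) : prodFp := fun p => f p + g p.
Let mul (f g : prodFp) : prodFp := fun p => f p * g p.
Let opp (f : prodFp) : prodFp := fun p => - f p.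
Let zero : prodFp := fun=> 0.
Let one : prodFp := fun=> 1.

Let addA : associative add.
Proof. by move=> f g h; apply: functional_extensionality_dep => p; apply: addrA. Qed.
Let addC : commutative add.
Proof. by move=> f g; apply: functional_extensionality_dep => p; apply: addrC. Qed.
Let add0 : left_id zero add.
Proof. by move=> f; apply: functional_extensionality_dep => p; apply: add0r. Qed.
Let addN : left_inverse zero opp add.
Proof. by move=> f; apply: functional_extensionality_dep => p; apply: addNr. Qed.

HB.instance Definition _ := GRing.isZmodule.Build prodFp addA addC add0 addN.

Let mulA : associative mul.
Proof. by move=> f g h; apply: functional_extensionality_dep => p; apply: mulrA. Qed.
Let mulC : commutative mul.
Proof. by move=> f g; apply: functional_extensionality_dep => p; apply: mulrC. Qed.
Let mul1 : left_id one mul.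
Proof. by move=> f; apply: functional_extensionality_dep => p; apply: mul1r. Qed.
Let mulD : left_distributive mul +%R.
Proof. by move=> f g h; apply: functional_extensionality_dep => p; apply: mulrDl. Qed.
Let one_neq0 : one != 0.
Proof.
apply/eqP => e.
have := congr1 (fun f : prodFp => f (exist _ 2 isT)) e.
by move/eqP; rewrite oner_eq0.
Qed.

HB.instance Definition _ :=
  GRing.Zmodule_isComNzRing.Build prodFp mulA mulC mul1 mulD one_neq0.

End ProdFpRing.

Definition sumFp : {pred prodFp} :=
  fun f => `[< finite_set [set p : primeT | f p <> 0] >].

Lemma infinite_primeT : infinite_set [set: primeT].
Proof.
move=> /(finite_image sval) /finite_fsetP [X eX].
pose N := \max_(x <- X) x.
have [p ltNp pr_p] := prime_above N.
have : (sval @` [set: primeT]) p by exists (exist _ p pr_p).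
rewrite eX /= => pX.
by move: ltNp; rewrite ltnNge (leq_bigmax_seq p pX).
Qed.

Lemma sumFp_idealr : idealr_closed sumFp.
Proof.
split.
- apply/asboolP; rewrite (_ : [set _ | _] = set0); first exact: finite_set0.
  by apply/seteqP; split=> p //=; case.
- apply/negP => /asboolP h; apply: infinite_primeT; apply: sub_finite_set h.
  by move=> p _ /=; apply/eqP; apply: oner_neq0.
move=> a u v /asboolP fu /asboolP fv; apply/asboolP.
have fuv : finite_set ([set p : primeT | u p <> 0] `|` [set p : primeT | v p <> 0]).
  by rewrite finite_setU.
apply: sub_finite_set fuv => p /= h.
case: (eqVneq (u p) 0) => [u0|/eqP]; last by left.
right=> v0; apply: h; change (a p * u p + v p = 0).
by rewrite u0 v0 mulr0 addr0.
Qed.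

HB.instance Definition _ := isIdealr.Build prodFp sumFp sumFp_idealr.

Definition scrA : Type := {ideal_quot sumFp}.
HB.instance Definition _ := GRing.ComNzRing.on scrA.

Definition toA (f : prodFp) : scrA := \pi_{ideal_quot sumFp} f.

Definition DD : Type := {a : int | a != 0}.
HB.instance Definition _ := Choice.on DD.

Definition sgnD (a : DD) : int := sgz (sval a).
Definition absD (a : DD) : nat := `|sval a|%N.

Definition weight (a : seq DD) : nat := (\sum_(x <- a) absD x)%N.
Definition sgn (a : seq DD) : int := \prod_(x <- a) sgnD x.

(* The condition [path ltn 0 ms] says 0 < m_1 < ... < m_r. Each m_i is then
   invertible in 'F_p, so the summand is the reduction of the rational one. *)
Definition zeta_mod (a : seq DD) : prodFp := fun p =>
  \sum_(ms : (size a).-tuple 'I_(sval p) |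
          path ltn 0 [seq nat_of_ord x | x <- ms])
    \prod_(i < size a)
      ((sgnD (tnth (in_tuple a) i))%:~R ^+ tnth ms i
       / (tnth ms i)%:R ^+ absD (tnth (in_tuple a) i)).

Definition zetaA (a : seq DD) : scrA := toA (zeta_mod a).

Definition Ssgn (i j : nat) : set (i.+1.-tuple DD) :=
  [set a | weight a = (i + j + 1)%N].
Arguments Ssgn : clear implicits.

(* Needed because a sum [\sum_(a \in S) F a] over an infinite set S may be
   the junk value 0. *)
Lemma finite_Ssgn i j : finite_set (Ssgn i j).
Proof.
pose N := (i + j + 1)%N; pose d0 : DD := exist _ 1 isT.
pose g (x : bool * 'I_N.+1) : DD := insubd d0 ((-1) ^+ x.1 * (x.2 : nat)%:Z).
apply: (@sub_finite_set _ _
  ((fun t : i.+1.-tuple (bool * 'I_N.+1) => [tuple of map g t]) @` setT));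
  last by apply: finite_image; apply: finite_finset.
move=> a /= wa.
have le_a x : x \in tval a -> (absD x < N.+1)%N.
  move=> xa; rewrite ltnS /N -wa /weight (big_rem x) //=; exact: leq_addr.
exists [tuple of map (fun x : DD => (sval x < 0, inord (absD x))) a] => //.
apply: val_inj => /=; rewrite -map_comp -[RHS]map_id; apply/eq_in_map => x xa /=.
apply: val_inj; rewrite /g /= inordK ?le_a //.
have e : (-1) ^+ (sval x < 0)%R * (absD x)%:Z = sval x.
  by rewrite /absD abszE mulr_sign_norm.
by rewrite e insubdK //; exact: (svalP x).
Qed.


Definition lam1 : {mpoly scrA[4]} := 'X_(@Ordinal 4 0 isT).
Definition lam2 : {mpoly scrA[4]} := 'X_(@Ordinal 4 1 isT).
Definition mu1 : {mpoly scrA[4]} := 'X_(@Ordinal 4 2 isT).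
Definition mu2 : {mpoly scrA[4]} := 'X_(@Ordinal 4 3 isT).

(* Main.v *)
Require Import Defs.
From HB Require Import structures.
From mathcomp Require Import all_boot all_order all_algebra.
From mathcomp Require Import boolp classical_sets functions cardinality fsbigop.
From mathcomp Require Import mpoly.
From mathcomp Require Import zify ring.

(** Fix an odd prime p. Summing over the exponents and signs of an index turns
    each summation variable m into the factor C(m) = e(m) / (m - u), with
    e(m) = 1 + (-1)^m, where u marks the weight and a second variable l marks the
    depth; the generating series of the chains 0 < m_1 < ... < m_r = x is then
    f(x) = C(x) prod_{0 < y < x} (1 + l C(y)). The twist by sgn(beta) replaces
    e(m) by 1 - (-1)^m, and the reflection m -> p - m, which exchanges parities,
    turns the first sum of the theorem into - sum_{x + y < p} f_1(x) f_2(y). The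
    second sum is sum_{n < p} h(n), where h(n) collects the chains ending at n that
    are weighted by f_1 + f_2 up to some x and by (l_1 + l_2, u_1 + u_2) afterwards.
    Both n |-> sum_{x + y = n} f_1(x) f_2(y) and h solve
    (n - u_1 - u_2) X(n)
      = e(n) (sum_{x < n} (f_1 + f_2)(x) + (l_1 + l_2) sum_{z < n} X(z)),
    hence they agree for n < p. *)

Set Implicit Arguments.
Unset Strict Implicit.
Unset Printing Implicit Defensive.

Import Order.TTheory GRing.Theory Num.Theory.
Local Open Scope ring_scope.

(** * Products and sums over chains *)

Section Chains.
Variable G : comNzRingType.
Implicit Types (C I f g : nat -> G) (L U : G) (lo hi x y n N : nat).

(** Expanded, this is the sum over all chains, possibly empty, strictly between [lo] and [hi], each
    member y weighted by [L * C y]. *)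
Definition chain_prod L C lo hi : G := \prod_(lo.+1 <= y < hi) (1 + L * C y).

Lemma chain_prod_small L C lo hi : (hi <= lo.+1)%N -> chain_prod L C lo hi = 1.
Proof. by move=> h; rewrite /chain_prod big_geq. Qed.

Lemma chain_prodS L C lo hi : (lo < hi)%N ->
  chain_prod L C lo hi.+1 = chain_prod L C lo hi * (1 + L * C hi).
Proof. by move=> h; rewrite /chain_prod big_nat_recr. Qed.

(** Either no member follows x, or the chain after x has a largest member z. *)
Lemma chain_prod_weighted L C g n :
  \sum_(1 <= x < n) g x * chain_prod L C x n =
  \sum_(1 <= x < n) g x +
    L * \sum_(1 <= z < n) \sum_(1 <= x < z) g x * (C z * chain_prod L C x z).
Proof.
elim: n => [|n IH]; first by rewrite !big_geq ?mulr0 ?addr0.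
case: n IH => [|n] IH; first by rewrite !big_geq ?mulr0 ?addr0.
rewrite !(@big_nat_recr _ _ _ n.+1) //= chain_prod_small //.
rewrite (eq_big_nat _ _ (F2 := fun x => g x * chain_prod L C x n.+1
   + L * (g x * (C n.+1 * chain_prod L C x n.+1)))); last first.
  by move=> x /andP[_ hx]; rewrite chain_prodS //; ring.
rewrite big_split /= -big_distrr /= {}IH; ring.
Qed.

(** A nonempty chain is split at its smallest member; [chain_prod_last] splits it at its largest. *)
Lemma chain_prod_first L C lo hi :
  chain_prod L C lo hi = 1 + L * \sum_(lo.+1 <= x < hi) C x * chain_prod L C x hi.
Proof.
elim: hi => [|n IH]; first by rewrite chain_prod_small // big_geq ?mulr0 ?addr0.
case: (leqP n lo) => h; first by rewrite chain_prod_small // big_geq ?mulr0 ?addr0.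
rewrite chain_prodS // big_nat_recr //= (chain_prod_small _ _ (leqnn _)).
rewrite (eq_big_nat _ _ (F2 := fun x => C x * chain_prod L C x n * (1 + L * C n))).
  by rewrite -big_distrl /= {1}IH; ring.
by move=> x /andP[_ hx]; rewrite chain_prodS // mulrA.
Qed.

Lemma chain_prod_last L C lo hi :
  chain_prod L C lo hi = 1 + L * \sum_(lo.+1 <= x < hi) C x * chain_prod L C lo x.
Proof.
elim: hi => [|n IH]; first by rewrite chain_prod_small // big_geq ?mulr0 ?addr0.
case: (leqP n lo) => h; first by rewrite chain_prod_small // big_geq ?mulr0 ?addr0.
by rewrite chain_prodS // big_nat_recr //= [in RHS]mulrDr addrA -IH; ring.
Qed.

(** Multiplied by [L], both sides become [chain_prod L C lo hi - 1]. Since [L] need not be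
    cancellable, the proof is by induction on [hi]. *)
Lemma chain_sum_first_last L C lo hi :
  \sum_(lo.+1 <= x < hi) C x * chain_prod L C x hi =
  \sum_(lo.+1 <= x < hi) C x * chain_prod L C lo x.
Proof.
elim: hi => [|n IH]; first by rewrite !big_geq.
case: (leqP n lo) => h; first by rewrite !big_geq.
rewrite !big_nat_recr //= -IH chain_prod_small // (chain_prod_first L C lo n).
rewrite (eq_big_nat _ _ (F2 := fun x => C x * chain_prod L C x n * (1 + L * C n))).
  by rewrite -big_distrl /=; ring.
by move=> x /andP[_ hx]; rewrite chain_prodS // mulrA.
Qed.

(** The recursion expresses [E lo] through values at larger arguments, so it determines [E] by
    descending induction, and the splitting at the smallest member supplies the solution. *)
Lemma chain_rec_solve L C N x (E : nat -> G) : (x < N)%N ->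
  (forall lo, (lo < N)%N ->
     E lo = (lo < x)%:R * C x + L * \sum_(lo.+1 <= y < N) C y * E y) ->
  forall lo, (lo < N)%N -> E lo = (lo < x)%:R * (C x * chain_prod L C lo x).
Proof.
move=> xN hE lo; have [k] := ubnP (N - lo); elim: k lo => // k IH lo hk hlo.
rewrite hE //; rewrite (eq_big_nat _ _
  (F2 := fun y => C y * ((y < x)%:R * (C x * chain_prod L C y x)))); last first.
  by move=> y /andP[h1 h2]; rewrite IH //; lia.
case: (ltnP lo x) => h; last first.
  rewrite big_nat big1 ?mulr0 ?mul0r ?addr0 // => y /andP[h1 _].
  by rewrite ltnNge (leq_trans h (ltnW h1)) mul0r mulr0.
rewrite (big_cat_nat (n := x)) //=; last exact: ltnW.
rewrite [X in L * (_ + X)]big_nat [X in L * (_ + X)]big1 ?addr0; last first.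
  by move=> y /andP[h1 _]; rewrite ltnNge h1 mul0r mulr0.
rewrite (eq_big_nat _ _ (F2 := fun y => C x * (C y * chain_prod L C y x))).
  by rewrite -big_distrr /= (chain_prod_first L C lo x) mulr1n; ring.
by move=> y /andP[_ ->]; rewrite mulr1n; ring.
Qed.

(** * Convolution of chain series *)

Definition conv f g n : G := \sum_(1 <= x < n) f x * g (n - x)%N.
Definition psum f n : G := \sum_(1 <= x < n) f x.

Lemma convC f g n : conv f g n = conv g f n.
Proof.
rewrite /conv big_nat_rev /=; apply: eq_big_nat => x /andP[h1 h2].
by rewrite mulrC; congr (g _ * f _); lia.
Qed.

(** Both sides sum f(x) g(y) over positive x, y with x + y < n. *)
Lemma conv_psum f g n : conv (psum f) g n = psum (conv f g) n.
Proof.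
elim: n => [|n IH]; first by rewrite /conv /psum !big_geq.
case: n IH => [|n] IH; first by rewrite /conv /psum !big_geq.
rewrite -/(conv _ _ _) /psum big_nat_recr //= -/(psum _ _) -IH /conv.
rewrite big_nat_recl //= big_geq // mul0r add0r -big_split /=.
by apply: eq_big_nat => x /andP[h1 h2]; rewrite subSS /psum big_nat_recr //= mulrDl.
Qed.

(** Chains with largest member x; that member carries no factor [L], so the exponent of [L] is the
    depth minus one. *)
Definition chain_end L C x : G := C x * chain_prod L C 0 x.

(* Both sides satisfy the recursion in n whose coefficient is n - U1 - U2; for the
   left-hand side this comes from n - U1 - U2 = (x - U1) + (n - x - U2). *)
Lemma conv_chain_end N (e I1 I2 I3 : nat -> G) L1 L2 U1 U2 :
  (forall x y, e x * e y = e (x + y)%N * e y) ->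
  (forall n, (0 < n < N)%N -> (n%:R - U1) * I1 n = 1) ->
  (forall n, (0 < n < N)%N -> (n%:R - U2) * I2 n = 1) ->
  (forall n, (0 < n < N)%N -> (n%:R - (U1 + U2)) * I3 n = 1) ->
  let C1 n := e n * I1 n in let C2 n := e n * I2 n in let C3 n := e n * I3 n in
  let f1 := chain_end L1 C1 in let f2 := chain_end L2 C2 in
  forall n, (0 < n < N)%N -> conv f1 f2 n =
  \sum_(1 <= x < n) (f1 x + f2 x) * (C3 n * chain_prod (L1 + L2) C3 x n).
Proof.
move=> he h1 h2 h3 C1 C2 C3 f1 f2.
have chainE L C x : chain_prod L C 0 x = 1 + L * psum (chain_end L C) x.
  exact: chain_prod_last.
have E1 x : (0 < x < N)%N -> (x%:R - U1) * f1 x = e x * chain_prod L1 C1 0 x.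
  by move=> hx; rewrite -[RHS]mul1r -[X in _ = X * _](h1 x hx) /f1 /chain_end /C1; ring.
have E2 x : (0 < x < N)%N -> (x%:R - U2) * f2 x = e x * chain_prod L2 C2 0 x.
  by move=> hx; rewrite -[RHS]mul1r -[X in _ = X * _](h2 x hx) /f2 /chain_end /C2; ring.
(* [f1 y] contains the factor [e y], so [he] applies. For x + y = n this yields the common factor
   [e n]. *)
have ef1 x y : e x * f1 y = e (x + y)%N * f1 y.
  by rewrite /f1 /chain_end /C1 !mulrA he.
have ef2 x y : e x * f2 y = e (x + y)%N * f2 y.
  by rewrite /f2 /chain_end /C2 !mulrA he.
have recl n : (0 < n < N)%N -> (n%:R - (U1 + U2)) * conv f1 f2 n =
    e n * (\sum_(1 <= x < n) (f1 x + f2 x) + (L1 + L2) * psum (conv f1 f2) n).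
  move=> hn; rewrite /conv big_distrr /=.
  rewrite (eq_big_nat _ _ (F2 := fun x =>
     e n * ((f1 x + f2 (n - x)%N) + (L1 * (psum f1 x * f2 (n - x)%N)
      + L2 * (f1 x * psum f2 (n - x)%N))))); last first.
    move=> x hx.
    have hx1 : (0 < x < N)%N by lia.
    have hx2 : (0 < n - x < N)%N by lia.
    transitivity (((x%:R - U1) * f1 x) * f2 (n - x)%N
       + ((n - x)%:R - U2) * f2 (n - x)%N * f1 x).
      by rewrite natrB ?(ltnW (proj2 (andP hx))) //; ring.
    rewrite E1 // E2 // mulrAC ef2 [e _ * _ * f1 x]mulrAC ef1.
    rewrite subnK ?subnKC ?(ltnW (proj2 (andP hx))) // !chainE -/f1 -/f2; ring.
  rewrite -big_distrr /= !big_split /= -!big_distrr /=.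
  rewrite -/(conv (psum f1) f2 n) -/(conv f1 (psum f2) n) conv_psum.
  rewrite (convC f1 (psum f2)) conv_psum.
  have -> : psum (conv f2 f1) n = psum (conv f1 f2) n.
    by apply: eq_bigr => i _; rewrite convC.
  rewrite [X in _ + X + _](_ : _ = \sum_(1 <= x < n) f2 x).
    by congr (_ * _); ring.
  rewrite big_nat_rev /=; apply: eq_big_nat => x hx; congr f2; lia.
pose h n :=
  \sum_(1 <= x < n) (f1 x + f2 x) * (C3 n * chain_prod (L1 + L2) C3 x n).
have recr n : (0 < n < N)%N -> (n%:R - (U1 + U2)) * h n =
    e n * (\sum_(1 <= x < n) (f1 x + f2 x) + (L1 + L2) * psum h n).
  move=> hn; rewrite /psum /h -chain_prod_weighted !big_distrr /=.
  apply: eq_bigr => x _; rewrite -[RHS]mul1r -[X in _ = X * _](h3 n hn) /C3; ring.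
move=> n; have [k] := ubnP n; elim: k n => // k IH n hk hn.
(* The coefficient n - (U1 + U2) has inverse [I3 n], so it suffices to compare the right-hand sides
   of [recl] and [recr], which involve only arguments below n. *)
rewrite -/(h n) -[LHS]mul1r -[RHS]mul1r.
rewrite -[X in X * _ = _](h3 n hn) -[X in _ = X * _](h3 n hn).
rewrite ![_ * I3 n]mulrC -!mulrA recl // [in RHS]recr //.
congr (_ * (_ * (_ + _ * _))); apply: eq_big_nat => x hx; apply: IH; lia.
Qed.

End Chains.

(** * Formal power series *)

(** Series rather than polynomials, since 1 / (m - u) has infinitely many terms. The alias carries
    the Cauchy product in place of the pointwise one. *)
Definition fps (R : Type) : Type := nat -> R.
HB.instance Definition _ (R : zmodType) := GRing.Zmodule.copy (fps R) (nat -> R).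

Section FpsRing.
Variable R : comNzRingType.
Implicit Types f g h : fps R.

Definition fps_mul f g : fps R := fun n => \sum_(i < n.+1) f i * g (n - i)%N.
Definition fps_one : fps R := fun n => (n == 0)%:R.

Definition fps_trunc n f : {poly R} := \poly_(i < n.+1) f i.

(** Up to degree n a product sees only truncations, so associativity and commutativity are inherited
    from [{poly R}]. *)
Lemma coef_fps_truncM n f g i : (i <= n)%N ->
  (fps_trunc n f * fps_trunc n g)`_i = fps_mul f g i.
Proof.
move=> le_in; rewrite coefM; apply: eq_bigr => j _; rewrite !coef_poly.
by rewrite !ifT // ltnS; have := ltn_ord j; lia.
Qed.

Lemma coef_truncM n (p q q' : {poly R}) : (forall i, (i <= n)%N -> q`_i = q'`_i) ->
  (p * q)`_n = (p * q')`_n.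
Proof. by move=> h; rewrite !coefM; apply: eq_bigr => j _; rewrite h ?leq_subr. Qed.

Lemma fps_mulC : commutative fps_mul.
Proof.
by move=> f g; apply/funext => n; rewrite -!(coef_fps_truncM _ _ (leqnn n)) mulrC.
Qed.

Lemma fps_mulA : associative fps_mul.
Proof.
have trunc_mul f g n i : (i <= n)%N ->
    (fps_trunc n (fps_mul f g))`_i = (fps_trunc n f * fps_trunc n g)`_i.
  by move=> h; rewrite coef_poly ltnS h coef_fps_truncM.
move=> f g h; apply/funext => n; rewrite -!(coef_fps_truncM _ _ (leqnn n)).
rewrite (coef_truncM _ (trunc_mul g h n)) mulrA.
rewrite ![_ * fps_trunc n h]mulrC.
by apply: coef_truncM => i /(trunc_mul f g n i) ->.
Qed.

Lemma fps_mul1 : left_id fps_one fps_mul.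
Proof.
move=> f; apply/funext => n; rewrite /fps_mul big_ord_recl big1 ?addr0.
  by rewrite mul1r subn0.
by move=> i _; rewrite mul0r.
Qed.

Lemma fps_mulDl : left_distributive fps_mul +%R.
Proof.
move=> f g h; apply/funext => n.
change (fps_mul (f + g) h n = fps_mul f h n + fps_mul g h n).
rewrite /fps_mul -big_split /=.
by apply: eq_bigr => i _; rewrite -mulrDl.
Qed.

Lemma fps_one_neq0 : fps_one != 0.
Proof.
apply/eqP => /(congr1 (fun f : fps R => f 0%N)) /eqP.
by rewrite [fps_one _]/= oner_eq0.
Qed.

HB.instance Definition _ := GRing.Zmodule_isComNzRing.Build (fps R)
  fps_mulA fps_mulC fps_mul1 fps_mulDl fps_one_neq0.

Lemma fpsME f g n : (f * g) n = \sum_(i < n.+1) f i * g (n - i)%N.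
Proof. by []. Qed.

Lemma fpsDE f g n : (f + g) n = f n + g n.
Proof. by []. Qed.

Lemma fpsNE f n : (- f) n = - f n.
Proof. by []. Qed.

Lemma fps0E n : (0 : fps R) n = 0.
Proof. by []. Qed.

Lemma fps1E n : (1 : fps R) n = (n == 0%N)%:R.
Proof. by []. Qed.

Lemma fps_sumE I (r : seq I) (P : pred I) (F : I -> fps R) n :
  (\sum_(i <- r | P i) F i) n = \sum_(i <- r | P i) F i n.
Proof.
exact: (big_morph (fun f : fps R => f n) (fun f g => fpsDE f g n) (fps0E n)).
Qed.

Definition fpsC (c : R) : fps R := fun n => (n == 0%N)%:R * c.
Definition fpsX (c : R) : fps R := fun n => (n == 1%N)%:R * c.

Lemma fpsCM c f n : (fpsC c * f) n = c * f n.
Proof.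
rewrite fpsME big_ord_recl big1 ?addr0 ?subn0 /fpsC ?mul1r //.
by move=> i _; rewrite /= !mul0r.
Qed.

Lemma fpsXM c f n : (fpsX c * f) n = if n is n'.+1 then c * f n' else 0.
Proof.
rewrite fpsME big_ord_recl /= {1}/fpsX !mul0r add0r.
case: n => [|n]; first by rewrite big_ord0.
rewrite big_ord_recl big1 ?addr0 /fpsX /= ?mul1r ?subSS ?subn0 //.
by move=> i _; rewrite /= !mul0r.
Qed.

Lemma fpsC_zmod_morphism : zmod_morphism fpsC.
Proof. by move=> a b; apply/funext => n; rewrite fpsDE fpsNE /fpsC mulrBr. Qed.

Lemma fpsC_monoid_morphism : monoid_morphism fpsC.
Proof.
split=> [|a b]; apply/funext => n; first by rewrite fps1E /fpsC mulr1.
by rewrite fpsCM /fpsC mulrCA.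
Qed.

HB.instance Definition _ :=
  GRing.isZmodMorphism.Build _ _ fpsC fpsC_zmod_morphism.
HB.instance Definition _ :=
  GRing.isMonoidMorphism.Build _ _ fpsC fpsC_monoid_morphism.

Lemma fps_natr n : n%:R = fpsC n%:R.
Proof.
apply/funext; elim: n => [|n IH] k; first by rewrite /fpsC mulr0.
by rewrite !mulrS fpsDE IH fps1E /fpsC mulrDr mulr1.
Qed.

End FpsRing.

(** * Sums over indices *)

Lemma big_tuple_cons (V : nmodType) (T : finType) n
    (P : pred (n.+1.-tuple T)) (F : n.+1.-tuple T -> V) :
  \sum_(t | P t) F t =
  \sum_(x : T) \sum_(t : n.-tuple T | P (cons_tuple x t)) F (cons_tuple x t).
Proof.
rewrite pair_big_dep /= (reindex (fun q : T * n.-tuple T => cons_tuple q.1 q.2)) //.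
exists (fun t => (thead t, behead_tuple t)) => [[x t]|t] _ /=.
  by congr pair; apply: val_inj.
by rewrite [RHS]tuple_eta; apply: val_inj.
Qed.

Section ChainSum.
Variables (K : comNzRingType) (p : nat) (w : DD -> nat -> K).

(** Chains lo < m_1 < ... < m_r = x. Fixing both ends makes concatenation of indices a matrix
    product, with the identity matrix for the empty index. *)
Fixpoint chain_sum (a : seq DD) (lo x : nat) : K :=
  if a is d :: a' then \sum_(lo.+1 <= y < p) w d y * chain_sum a' y x
  else (lo == x)%:R.

(** The chain is cut at y, the last member belonging to [a], or [lo] itself if [a] is empty. *)
Lemma chain_sum_cat a b lo x : (lo < p)%N ->
  chain_sum (a ++ b) lo x = \sum_(0 <= y < p) chain_sum a lo y * chain_sum b y x.
Proof.
elim: a lo => [|d a IH] lo hlo /=.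
  rewrite (bigD1_seq lo) ?mem_index_iota ?iota_uniq //= eqxx mul1r big1 ?addr0 //.
  by move=> y; rewrite eq_sym => /negPf->; rewrite mul0r.
under [RHS]eq_bigr do rewrite big_distrl /=.
rewrite exchange_big /=; apply: eq_big_nat => y /andP[_ hy].
by rewrite IH // big_distrr /=; apply: eq_bigr => z _; rewrite mulrA.
Qed.

(** Puts the tuple sum defining [zeta_mod] into recursive form, with the last member x left free. *)
Lemma chain_sum_tuples a lo : (lo < p)%N ->
  \sum_(ms : (size a).-tuple 'I_p | path ltn lo [seq nat_of_ord x | x <- ms])
    \prod_(i < size a) w (tnth (in_tuple a) i) (tnth ms i) =
  \sum_(0 <= x < p) chain_sum a lo x.
Proof.
elim: a lo => [|d a IH] lo hlo /=.
  rewrite (bigD1_seq lo) ?mem_index_iota ?iota_uniq //= eqxx.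
  rewrite [X in _ = _ + X]big1; last first.
    by move=> y; rewrite eq_sym => /negPf->.
  rewrite (big_pred1 [tuple]) ?big_ord0 ?addr0 // => t /=.
  by rewrite (tuple0 t); apply/esym/eqP.
rewrite big_tuple_cons /= [RHS]exchange_big /= (big_nat_widenl _ 0) //= big_mkord.
rewrite [RHS]big_mkcond; apply: eq_bigr => y _; case: ifP => hy; last first.
  by rewrite big_pred0 // => t; rewrite hy.
rewrite -big_distrr -(IH y) //= big_distrr; apply: eq_bigr => ms _.
rewrite big_ord_recl !(tnth_nth d) /= !(tnth_nth y) /=; congr (_ * _).
by apply: eq_bigr => i _; rewrite !(tnth_nth d) !(tnth_nth y).
Qed.

End ChainSum.

(** * Enumeration of indices of given depth and weight *)

Lemma mkDD_proof (b : bool) (j : nat) : (-1) ^+ b * j.+1%:Z != 0.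
Proof. by rewrite mulf_neq0 ?signr_eq0. Qed.

(** A sign bit and the absolute value minus one: the shift makes [j] the contribution of the entry
    to weight minus depth. *)
Definition mkDD b j : DD := exist (fun a : int => a != 0) _ (mkDD_proof b j).

Lemma absD_mkDD b j : absD (mkDD b j) = j.+1.
Proof. by rewrite /absD /= abszMsign. Qed.

Lemma sgnD_mkDD b j : sgnD (mkDD b j) = (-1) ^+ b.
Proof. by case: b. Qed.

Lemma mkDDE (d : DD) : {b & {j | d = mkDD b j}}.
Proof.
exists (sval d < 0), (absD d).-1; apply: val_inj => /=.
rewrite prednK; last by rewrite /absD absz_gt0; exact: svalP d.
by rewrite /absD abszE mulr_sign_norm.
Qed.

Lemma mkDD_inj b j b' j' : mkDD b j = mkDD b' j' -> b = b' /\ j = j'.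
Proof.
move=> e; have := congr1 absD e; rewrite !absD_mkDD => -[->]; split=> //.
by have := congr1 sgnD e; rewrite !sgnD_mkDD; case: b {e}; case: b'.
Qed.

Lemma weight_cons d a : weight (d :: a) = (absD d + weight a)%N.
Proof. by rewrite /weight big_cons. Qed.

Lemma weight_ge_size a : (size a <= weight a)%N.
Proof.
elim: a => //= d a IH; rewrite weight_cons; case: (mkDDE d) => b [j ->].
by rewrite absD_mkDD; lia.
Qed.

Definition DD_upto k : seq (bool * nat) :=
  [seq (b, j) | b <- [:: false; true], j <- iota 0 k.+1].

(** Lists [Ssgn r k]. Here k is the weight minus the depth, and the first entry uses up [q.2] of
    it. *)
Fixpoint Senum r k : seq (r.+1.-tuple DD) :=
  if r is r'.+1 then
    [seq cons_tuple (mkDD q.1 q.2) t | q <- DD_upto k, t <- Senum r' (k - q.2)%N]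
  else [seq [tuple mkDD b k] | b <- [:: false; true]].

Lemma mem_DD_upto k b j : ((b, j) \in DD_upto k) = (j <= k)%N.
Proof.
apply/allpairsP/idP => [[[b' j'] [_]] | hj].
  by rewrite mem_iota => /andP[_ ?] [_ ->].
by exists (b, j); rewrite mem_iota; split => //; case: b.
Qed.

Lemma mem_Senum r k (a : r.+1.-tuple DD) :
  (a \in Senum r k) = (weight a == r + k + 1)%N.
Proof.
elim: r k a => [|r IH] k a.
  case/tupleP: a => d t; rewrite (tuple0 t) weight_cons /weight big_nil.
  case: (mkDDE d) => b [j ->]; rewrite absD_mkDD.
  apply/mapP/eqP => [[b' _ /(congr1 (@thead _ _))]|].
    by rewrite !theadE => /mkDD_inj[_ ->]; lia.
  move=> e; have -> : j = k by lia.
  by exists b; [case: b | apply: val_inj].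
case/tupleP: a => d t; rewrite weight_cons.
(* The remaining [r.+1] entries have weight at least [r.+1], which forces j <= k. *)
have := weight_ge_size t; rewrite size_tuple.
case: (mkDDE d) => b [j ->] ht; rewrite absD_mkDD.
apply/allpairsPdep/eqP => [[[b' j'] [t' [/=]]]|e].
  rewrite mem_DD_upto IH => hj /eqP et e.
  have /mkDD_inj[_ ->] := congr1 (@thead _ _) e.
  have -> : val t = val t' by have := congr1 (fun u => behead (val u)) e.
  by rewrite et; lia.
exists (b, j), t; rewrite mem_DD_upto IH; split=> //; first lia.
by apply/eqP => /=; lia.
Qed.

Lemma uniq_Senum r k : uniq (Senum r k).
Proof.
elim: r k => [|r IH] k.
  rewrite map_inj_uniq // => b b' /(congr1 (@thead _ _)); rewrite !theadE.
  by case/mkDD_inj.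
apply: allpairs_uniq_dep => [|q _|]; rewrite ?IH //.
  by apply: allpairs_uniq; rewrite ?iota_uniq // => -[? ?] [? ?] _ _ [-> ->].
move=> [[b j] t] [[b' j'] t'] _ _ /= e.
have /mkDD_inj[/= eb ej] := congr1 (@thead _ _) e.
have et : t = t'.
  by apply: val_inj; have := congr1 (fun u => behead (val u)) e.
by rewrite eb ej et.
Qed.

Lemma fsbig_Ssgn (V : nmodType) r k (F : seq DD -> V) :
  (\sum_(a \in Ssgn r k) F a = \sum_(a <- Senum r k) F a)%R.
Proof.
rewrite (fsbig_seq _ _ (uniq_Senum r k)); apply: eq_fsbigl.
by apply/seteqP; split=> a /=; rewrite mem_Senum => /eqP.
Qed.

Lemma sum_Senum0 (V : nmodType) k (F : seq DD -> V) :
  \sum_(a <- Senum 0 k) F a = \sum_(b : bool) F [:: mkDD b k].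
Proof. by rewrite big_map big_bool /= !big_cons big_nil addr0 addrC. Qed.

Lemma sum_SenumS (V : nmodType) r k (F : seq DD -> V) :
  \sum_(a <- Senum r.+1 k) F a =
  \sum_(j < k.+1) \sum_(b : bool) \sum_(a <- Senum r (k - j)%N) F (mkDD b j :: a).
Proof.
rewrite big_allpairs_dep big_allpairs_dep exchange_big.
rewrite -[iota 0 k.+1]/(index_iota 0 k.+1) big_mkord.
by apply: eq_bigr => j _; rewrite big_bool !big_cons big_nil /= addr0 addrC.
Qed.

(** Only the sum of [w] over the two signs of the first entry enters; this is where the factor e(m)
    comes from. *)
Lemma sum_chain_sumS (K : comNzRingType) p w r k lo x :
  \sum_(a <- Senum r.+1 k) chain_sum p w a lo x =
  \sum_(j < k.+1) \sum_(lo.+1 <= y < p) (\sum_(b : bool) w (mkDD b j) y) *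
     \sum_(a <- Senum r (k - j)%N) chain_sum p w a y x :> K.
Proof.
rewrite (sum_SenumS _ _ (fun a => chain_sum p w a lo x)); apply: eq_bigr => j _ /=.
under [RHS]eq_bigr do rewrite big_distrl /=.
rewrite [RHS]exchange_big /=; apply: eq_bigr => b _.
by rewrite exchange_big /=; apply: eq_bigr => y _; rewrite big_distrr.
Qed.

Lemma sum_chain_sum0 (K : comNzRingType) p w k lo x : (x < p)%N ->
  \sum_(a <- Senum 0 k) chain_sum p w a lo x =
  (lo < x)%:R * \sum_(b : bool) w (mkDD b k) x :> K.
Proof.
move=> hx; rewrite (sum_Senum0 _ (fun a => chain_sum p w a lo x)) big_distrr.
apply: eq_bigr => b _ /=; case: (ltnP lo x) => h; last first.
  rewrite mul0r big_nat big1 // => y /andP[hy _].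
  by rewrite gtn_eqF ?mulr0 // (leq_ltn_trans h).
rewrite mul1r (bigD1_seq x) ?mem_index_iota ?iota_uniq ?h //= eqxx mulr1 big1 ?addr0 //.
by move=> y /negPf->; rewrite mulr0.
Qed.

(** * Generating series modulo p *)

Section GeneratingSeries.
Variables (p : nat) (pr_p : prime p).
Variables (R : comNzRingType) (phi : {rmorphism 'F_p -> R}).
Local Notation G := (fps (fps R)).
Implicit Types (l u : R) (w : DD -> nat -> 'F_p) (lo x y r k n m : nat).

(* The outer series variable records r, the depth minus one, and the inner one
   records k, the weight minus the depth. *)
Definition depth_var l : G := fpsX (fpsC l).
Definition weight_var u : G := fpsC (fpsX u).
(* The expansion of 1 / (m - u). Without the cast, Rocq would infer the pointwise
   ring structure on [nat -> R]. *)
Definition inv_series u m : G :=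
  fpsC ((fun k => u ^+ k * phi (m%:R ^- k.+1)) : fps R).

Lemma natFp_neq0 m : (0 < m < p)%N -> m%:R != 0 :> 'F_p.
Proof.
case/andP=> m0 mp; rewrite -(dvdn_pcharf (pchar_Fp pr_p)).
by apply/negP => /(dvdn_leq m0); rewrite leqNgt mp.
Qed.

Lemma natp0 (S : comNzRingType) (f : {rmorphism 'F_p -> S}) : p%:R = 0 :> S.
Proof. by rewrite -(rmorph_nat f) pchar_Fp_0 ?rmorph0. Qed.

(** The geometric series telescopes, m being invertible modulo p. *)
Lemma inv_seriesP u m : (0 < m < p)%N -> (m%:R - weight_var u) * inv_series u m = 1.
Proof.
move=> hm; have := natFp_neq0 hm; rewrite fps_natr /weight_var /inv_series.
rewrite -(rmorphB (@fpsC (fps R))) -(rmorphM (@fpsC (fps R))) => m0.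
rewrite -[RHS](rmorph1 (@fpsC (fps R))); congr fpsC; apply/funext => k.
rewrite mulrBl fpsDE fpsNE fps_natr fpsCM fpsXM fps1E -(rmorph_nat phi).
case: k => [|k]; first by rewrite subr0 mul1r -rmorphM divff ?rmorph1.
by rewrite mulrCA -rmorphM exprS invfM mulVKf // mulrA subrr.
Qed.

Definition chain_gen w l u lo x : G :=
  fun r k => l ^+ r * u ^+ k * phi (\sum_(a <- Senum r k) chain_sum p w a lo x).

(** Splitting off the first member shows that, for fixed x, [chain_gen] satisfies the recursion of
    [chain_rec_solve] in [lo]. *)
Lemma chain_genE w (s : nat -> int) l u :
  (forall k m, \sum_(b : bool) w (mkDD b k) m = (s m)%:~R * m%:R ^- k.+1) ->
  forall lo x, (lo < p)%N -> (x < p)%N ->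
  let C m := (s m)%:~R * inv_series u m in
  chain_gen w l u lo x = (lo < x)%:R * (C x * chain_prod (depth_var l) C lo x).
Proof.
move=> hw lo x hlo hx C; move: hlo.
have CE m : C m =
    fpsC ((fun k => u ^+ k * phi (\sum_(b : bool) w (mkDD b k) m)) : fps R).
  rewrite /C -(rmorph_int (@fpsC (fps R))) -(rmorphM (@fpsC (fps R))).
  congr fpsC; apply/funext => k.
  by rewrite -(rmorph_int (@fpsC R)) fpsCM hw rmorphM rmorph_int mulrCA.
apply: (@chain_rec_solve _ (depth_var l) C p x (fun lo => chain_gen w l u lo x))
  => // {}lo hlo.
apply/funext => r; apply/funext => k; rewrite !fpsDE [X in _ = X _ _ + _]mulrC.
have -> : (C x * (lo < x)%:R) r k =
    (r == 0%N)%:R * (u ^+ k * phi ((lo < x)%:R * \sum_(b : bool) w (mkDD b k) x)).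
  rewrite CE mulrC fps_natr fpsCM fps_natr fpsCM /fpsC.
  by case: (r == 0%N); rewrite ?mul0r ?mulr0 // !mul1r rmorphM rmorph_nat mulrCA.
(* For r = 0 the chain is the single point x and only the inhomogeneous term survives; for larger r
   only the recursive term does. *)
rewrite fpsXM; case: r => [|r].
  by rewrite fps0E addr0 /chain_gen expr0 !mul1r sum_chain_sum0.
rewrite mul0r add0r fpsCM !fps_sumE /chain_gen sum_chain_sumS rmorph_sum /=.
rewrite mulr_sumr.
have E y : (C y * chain_gen w l u y x) r k = \sum_(j < k.+1)
   u ^+ j * phi (\sum_(b : bool) w (mkDD b j) y) *
   (l ^+ r * u ^+ (k - j) * phi (\sum_(a <- Senum r (k - j)%N) chain_sum p w a y x)).
  by rewrite CE fpsCM.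
under [X in _ = _ * X]eq_bigr do rewrite E.
rewrite exchange_big mulr_sumr; apply: eq_bigr => j _ /=.
rewrite rmorph_sum !mulr_sumr; apply: eq_bigr => y _; rewrite rmorphM.
rewrite exprS -{1}(subnKC (leq_ord j)) exprD; ring.
Qed.

(** The two nested Cauchy products produce the sums over r_1 + r_2 = n and k_1 + k_2 = m; y is the
    last member belonging to the first index. *)
Lemma chain_gen_mul_coef w w' l u l' u' n m :
  (\sum_(0 <= y < p)
     chain_gen w l u 0 y * \sum_(0 <= x < p) chain_gen w' l' u' y x) n m =
  \sum_(i < n.+1) \sum_(j < m.+1)
    l ^+ i * l' ^+ (n - i) * u ^+ j * u' ^+ (m - j) *
    phi (\sum_(a <- Senum i j) \sum_(b <- Senum (n - i) (m - j))
      \sum_(0 <= y < p) \sum_(0 <= x < p)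
        chain_sum p w a 0 y * chain_sum p w' b y x).
Proof.
rewrite !fps_sumE.
under eq_bigr => y _ do (rewrite fpsME fps_sumE; under eq_bigr => i _ do rewrite fpsME).
rewrite exchange_big; apply: eq_bigr => i _ /=.
rewrite exchange_big; apply: eq_bigr => j _ /=.
under [in RHS]eq_bigr do rewrite exchange_big.
rewrite exchange_big rmorph_sum mulr_sumr; apply: eq_bigr => y _ /=.
rewrite !fps_sumE /chain_gen -mulr_sumr -rmorph_sum mulrACA -rmorphM -!mulrA.
rewrite [in LHS](mulrCA (u ^+ j)); do 4 congr (_ * _); congr (phi _).
rewrite mulr_suml; apply: eq_bigr => a _.
rewrite [X in _ * X]exchange_big mulr_sumr; apply: eq_bigr => b _.
by rewrite mulr_sumr.
Qed.

End GeneratingSeries.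

(** * Reflection m -> p - m and the identity of generating series *)

Lemma sum_indic_gt (S : comNzRingType) lo p (F : nat -> S) :
  \sum_(0 <= x < p) (lo < x)%:R * F x = \sum_(lo.+1 <= x < p) F x.
Proof.
rewrite [RHS](big_nat_widenl _ 0) //= [RHS]big_mkcond.
by apply: eq_bigr => x _; case: ifP; rewrite ?mul1r ?mul0r.
Qed.

Lemma sum_triangle (S : nmodType) p (F : nat -> nat -> S) :
  \sum_(1 <= y < p) \sum_(y.+1 <= x < p) F y x =
  \sum_(1 <= x < p) \sum_(1 <= y < x) F y x.
Proof.
elim: p => [|p IH]; first by rewrite !big_geq.
case: p IH => [|p] IH; first by rewrite !big_geq.
rewrite [LHS]big_nat_recr //= [RHS]big_nat_recr //= -IH (@big_geq _ _ _ p.+2) // addr0.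
by rewrite -big_split /=; apply: eq_big_nat => y /andP[_ hy]; rewrite big_nat_recr.
Qed.

(** Stated for a general operation because both the sum over end points and the product [chain_prod]
    get reflected. *)
Lemma big_nat_reflect (T : Type) (idx : T) (op : Monoid.com_law idx) p a b
    (F : nat -> T) : (a < p)%N -> (b <= p)%N ->
  \big[op/idx]_(a.+1 <= i < p - b) F i = \big[op/idx]_(b.+1 <= i < p - a) F (p - i)%N.
Proof.
move=> ap bp; case: (leqP (p - b) a.+1) => h.
  by rewrite !big_geq //; lia.
rewrite big_nat_rev /= -[b.+1]add1n -[a.+1]add1n !big_addn.
rewrite (_ : p - b - a = p - a - b)%N; last by lia.
by apply: eq_big_nat => i hi; congr F; lia.
Qed.

Section ModP.
Variables (p : nat) (pr_p : prime p).

Definition term (a : DD) (m : nat) : 'F_p := (sgnD a)%:~R ^+ m / m%:R ^+ absD a.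
(** sgn(beta) is multiplicative over the entries, so the twist can be absorbed into the weight of
    each member. *)
Definition sgn_term (a : DD) (m : nat) : 'F_p := (sgnD a)%:~R * term a m.

Lemma sum_term k m :
  \sum_(b : bool) term (mkDD b k) m = (1 + (-1) ^+ m)%:~R * m%:R ^- k.+1.
Proof.
rewrite big_bool /= /term !absD_mkDD !sgnD_mkDD expr0 expr1 -mulrDl addrC.
by rewrite rmorphD rmorphXn /= !rmorphN !rmorph1 expr1n.
Qed.

Lemma sum_sgn_term k m :
  \sum_(b : bool) sgn_term (mkDD b k) m = (1 - (-1) ^+ m)%:~R * m%:R ^- k.+1.
Proof.
rewrite big_bool /= /sgn_term /term !absD_mkDD !sgnD_mkDD expr0 expr1.
by rewrite !mulrA -mulrDl addrC rmorphB rmorphXn /= !rmorphN !rmorph1 expr1n mulr1 mulN1r.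
Qed.

Lemma chain_sum_sgn_term a lo x :
  chain_sum p sgn_term a lo x = (sgn a)%:~R * chain_sum p term a lo x.
Proof.
elim: a lo => [|d a IH] lo /=; first by rewrite /sgn big_nil mul1r.
rewrite mulr_sumr; apply: eq_bigr => y _.
by rewrite IH /sgn big_cons rmorphM /sgn_term mulrACA.
Qed.

Variables (R : comNzRingType) (phi : {rmorphism 'F_p -> R}).
Local Notation G := (fps (fps R)).
Implicit Types (l u : R).

Lemma depth_varD l l' : depth_var (l + l') = depth_var l + depth_var l'.
Proof.
apply/funext => r; apply/funext => k; rewrite /depth_var !fpsDE /fpsX rmorphD.
by rewrite mulrDr.
Qed.

Lemma weight_varD u u' : weight_var (u + u') = weight_var u + weight_var u'.
Proof.
rewrite /weight_var -(rmorphD (@fpsC (fps R))); congr fpsC; apply/funext => k.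
by rewrite fpsDE /fpsX mulrDr.
Qed.

Lemma depth_var0 : depth_var 0 = 0 :> G.
Proof. by apply/funext => r; rewrite /depth_var /fpsX rmorph0 mulr0. Qed.

Lemma weight_var0 : weight_var 0 = 0 :> G.
Proof.
rewrite /weight_var (_ : fpsX 0 = 0) ?rmorph0 //.
by apply/funext => k; rewrite /fpsX mulr0.
Qed.

Lemma depth_varN l : depth_var (- l) = - depth_var l.
Proof. by apply/eqP; rewrite -addr_eq0 -depth_varD addNr depth_var0. Qed.

Lemma weight_varN u : weight_var (- u) = - weight_var u.
Proof. by apply/eqP; rewrite -addr_eq0 -weight_varD addNr weight_var0. Qed.

Lemma fps_natp0 : p%:R = 0 :> G.
Proof. by rewrite !fps_natr (natp0 pr_p phi) !rmorph0. Qed.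

(** Modulo p, (p - m) + u = -(m - u), and inverses are unique. *)
Lemma inv_series_reflect u m : (0 < m < p)%N ->
  inv_series phi (- u) (p - m) = - inv_series phi u m.
Proof.
move=> hm; have hm' : (0 < p - m < p)%N by lia.
have h := inv_seriesP pr_p phi u hm; have h' := inv_seriesP pr_p phi (- u) hm'.
rewrite weight_varN natrB in h'; last by lia.
rewrite fps_natp0 in h'.
rewrite -[LHS]mul1r -[X in X * _]h -[inv_series phi u m in RHS]mul1r -[X in - (X * _)]h'.
ring.
Qed.

Lemma parity_reflect m : odd p -> (m <= p)%N ->
  1 - (-1) ^+ (p - m) = 1 + (-1) ^+ m :> int.
Proof.
move=> op mp; rewrite -[in LHS]signr_odd oddB // op -[in RHS]signr_odd.
by case: (odd m).
Qed.

Section Identity.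
Hypothesis odd_p : odd p.
Variables (l1 l2 u1 u2 : R).

Let e (m : nat) : G := (1 + (-1) ^+ m)%:~R.
Let f l u := chain_end (depth_var l) (fun m => e m * inv_series phi u m).

Lemma chain_gen_term l u y : (y < p)%N ->
  chain_gen phi term l u 0 y = (0 < y)%:R * f l u y.
Proof.
move=> hy; rewrite (@chain_genE _ _ phi term (fun m => 1 + (-1) ^+ m)) //.
  exact: sum_term.
exact: prime_gt0.
Qed.

(** Reflection sends chains above y to chains below p - y and negates every factor C. Each sign is
    cancelled by [- l2] except that of the end point, which has no depth factor. *)
Lemma chain_gen_sgn_term y : (0 < y < p)%N ->
  \sum_(0 <= x < p) chain_gen phi sgn_term (- l2) (- u2) y x = - psum (f l2 u2) (p - y).
Proof.
case/andP=> y0 yp; under eq_big_nat => x /andP[_ hx] do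
  rewrite (@chain_genE _ _ phi sgn_term (fun m => 1 - (-1) ^+ m) _ _ sum_sgn_term) //.
rewrite sum_indic_gt /= -[X in \sum_(_ <= _ < X) _]subn0 big_nat_reflect //.
(* The reflected end point is the smallest member, whereas [chain_end] singles out the largest. *)
rewrite /psum /f /chain_end -chain_sum_first_last -sumrN.
apply: eq_big_nat => x hx.
have xp : (0 < x < p)%N by lia.
rewrite parity_reflect ?inv_series_reflect //; last by lia.
rewrite mulrN mulNr; congr (- (_ * _)).
rewrite /chain_prod big_nat_reflect //; last by lia.
apply: eq_big_nat => z hz.
by rewrite parity_reflect ?inv_series_reflect ?depth_varN ?mulrN ?mulNr ?opprK //; lia.
Qed.

Lemma chain_gen_identity :
  \sum_(0 <= y < p) chain_gen phi term l1 u1 0 y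
     * \sum_(0 <= x < p) chain_gen phi sgn_term (- l2) (- u2) y x
  + \sum_(0 <= y < p) (chain_gen phi term l1 u1 0 y + chain_gen phi term l2 u2 0 y)
     * \sum_(0 <= x < p) chain_gen phi term (l1 + l2) (u1 + u2) y x = 0.
Proof.
have heads (F F' : nat -> G) : (forall y, (y < p)%N -> F y = (0 < y)%:R * F' y) ->
    forall H, \sum_(0 <= y < p) F y * H y = \sum_(1 <= y < p) F' y * H y.
  move=> hF H; rewrite -sum_indic_gt; apply: eq_big_nat => y /andP[_ hy].
  by rewrite hF // mulrA.
rewrite (heads _ _ (chain_gen_term l1 u1)).
rewrite (heads _ (fun y => f l1 u1 y + f l2 u2 y)); last first.
  by move=> y hy; rewrite !chain_gen_term // mulrDr.
rewrite (eq_big_nat _ _ (F2 := fun y => - (f l1 u1 y * psum (f l2 u2) (p - y)))); last first.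
  by move=> y hy; rewrite chain_gen_sgn_term // mulrN.
(* The sum over x + y < p is grouped by n = x + y, to be matched with the end point n of the chains
   in the second sum. *)
rewrite sumrN -/(conv _ _ p) convC conv_psum.
apply/eqP; rewrite addrC subr_eq0; apply/eqP.
under eq_big_nat => y /andP[_ hy].
  under eq_big_nat => x /andP[_ hx] do
    rewrite (@chain_genE _ _ phi term (fun m => 1 + (-1) ^+ m) _ _ sum_term) //.
  rewrite sum_indic_gt mulr_sumr /=.
  over.
rewrite sum_triangle; apply: eq_big_nat => n hn.
rewrite convC depth_varD.
rewrite (@conv_chain_end _ p e (inv_series phi u1) (inv_series phi u2)
  (inv_series phi (u1 + u2)) (depth_var l1) (depth_var l2)
  (weight_var u1) (weight_var u2)) //.
(* For odd y both sides vanish; for even y, x and x + y have the same parity. *)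
- move=> x y; rewrite /e -!rmorphM; congr (_%:~R).
  rewrite -(signr_odd _ x) -(signr_odd _ y) -(signr_odd _ (x + y)) oddD.
  by case: (odd x); case: (odd y).
- by move=> m hm; apply: inv_seriesP.
- by move=> m hm; apply: inv_seriesP.
- by move=> m hm; rewrite -weight_varD; apply: inv_seriesP.
Qed.

End Identity.
End ModP.

(** * Transfer to the ring of sequences modulo almost all primes *)

Lemma sum_antidiag (V : nmodType) n (F : nat -> nat -> V) :
  \sum_(r : 'I_n.+1 * 'I_n.+1 | (r.1 + r.2 == n)%N) F r.1 r.2 =
  \sum_(i < n.+1) F i (n - i)%N.
Proof.
rewrite -(pair_big_dep xpredT (fun i j : 'I_n.+1 => i + j == n)%N (fun i j => F i j)) /=.
apply: eq_bigr => i _; have hi := leq_ord i.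
rewrite (big_pred1 (inord (n - i))) ?inordK ?ltnS ?leq_subr // => j /=.
rewrite -val_eqE /= inordK ?ltnS ?leq_subr //; have hj := leq_ord j.
by apply/eqP/eqP; lia.
Qed.

Lemma sum_antidiag2 (V : nmodType) n m (F : nat -> nat -> nat -> nat -> V) :
  \sum_(r : 'I_n.+1 * 'I_n.+1 | (r.1 + r.2 == n)%N)
    \sum_(k : 'I_m.+1 * 'I_m.+1 | (k.1 + k.2 == m)%N) F r.1 k.1 r.2 k.2 =
  \sum_(i < n.+1) \sum_(j < m.+1) F i j (n - i)%N (m - j)%N.
Proof.
rewrite -(sum_antidiag n (fun r r' => \sum_(j < m.+1) F r j r' (m - j)%N)).
by apply: eq_bigr => r _; rewrite (sum_antidiag m (fun k k' => F r.1 k r.2 k')).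
Qed.

(** The ring is left abstract so that the formula can be carried along morphisms from the product of
    the prime fields to each factor and to the quotient. *)
Definition sum_formula (R : comNzRingType) (l1 l2 u1 u2 : R)
    (X Y : nat -> nat -> nat -> nat -> R) (n m : nat) : R :=
  \sum_(r : 'I_n.+1 * 'I_n.+1 | (r.1 + r.2 == n)%N)
    \sum_(k : 'I_m.+1 * 'I_m.+1 | (k.1 + k.2 == m)%N)
      (-1) ^+ (r.2 + k.2) * l1 ^+ r.1 * l2 ^+ r.2 * u1 ^+ k.1 * u2 ^+ k.2
      * X r.1 k.1 r.2 k.2
  + \sum_(r : 'I_n.+1 * 'I_n.+1 | (r.1 + r.2 == n)%N)
    \sum_(k : 'I_m.+1 * 'I_m.+1 | (k.1 + k.2 == m)%N)
      (l1 ^+ r.1 * u1 ^+ k.1 + l2 ^+ r.1 * u2 ^+ k.1)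
      * (l1 + l2) ^+ r.2 * (u1 + u2) ^+ k.2 * Y r.1 k.1 r.2 k.2.

Lemma rmorph_sum_formula (R S : comNzRingType) (f : {rmorphism R -> S})
    l1 l2 u1 u2 X Y n m :
  f (sum_formula l1 l2 u1 u2 X Y n m) =
  sum_formula (f l1) (f l2) (f u1) (f u2)
    (fun a b c d => f (X a b c d)) (fun a b c d => f (Y a b c d)) n m.
Proof.
rewrite /sum_formula rmorphD !rmorph_sum; congr (_ + _); apply: eq_bigr => r _;
  rewrite rmorph_sum; apply: eq_bigr => k _.
  by rewrite !rmorphM !rmorphXn rmorphN1.
by rewrite !rmorphM !rmorphXn !rmorphD !rmorphM !rmorphXn.
Qed.

Lemma eq_sum_formula (R : comNzRingType) (l1 l2 u1 u2 : R) X X' Y Y' n m :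
  (forall a b c d, X a b c d = X' a b c d) ->
  (forall a b c d, Y a b c d = Y' a b c d) ->
  sum_formula l1 l2 u1 u2 X Y n m = sum_formula l1 l2 u1 u2 X' Y' n m.
Proof.
by move=> eX eY; congr (_ + _); apply: eq_bigr => r _; apply: eq_bigr => k _;
  rewrite ?eX ?eY.
Qed.

Section ModPFormula.
Variable p : primeT.

Lemma zeta_mod_cat a b : zeta_mod (a ++ b) p =
  \sum_(0 <= y < sval p) \sum_(0 <= x < sval p)
    chain_sum (sval p) (@term (sval p)) a 0 y
    * chain_sum (sval p) (@term (sval p)) b y x.
Proof.
have p0 : (0 < sval p)%N by apply: prime_gt0; exact: svalP p.
rewrite [LHS](chain_sum_tuples (@term (sval p))) // exchange_big.
by apply: eq_bigr => x _; rewrite chain_sum_cat.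
Qed.

Lemma sum_formula_modp (R : comNzRingType) (phi : {rmorphism 'F_(sval p) -> R})
    l1 l2 u1 u2 n m : odd (sval p) ->
  sum_formula l1 l2 u1 u2
    (fun r k r' k' => phi (\sum_(a <- Senum r k) \sum_(b <- Senum r' k')
       (sgn b)%:~R * zeta_mod (a ++ b) p))
    (fun r k r' k' => phi (\sum_(a <- Senum r k) \sum_(b <- Senum r' k')
       zeta_mod (a ++ b) p)) n m = 0.
Proof.
move=> odd_p; have pr_p : prime (sval p) by exact: svalP p.
have := congr1 (fun F : fps (fps R) => F n m)
  (chain_gen_identity pr_p phi odd_p l1 l2 u1 u2).
(* Splitting the second sum leaves three products of the shape handled by [chain_gen_mul_coef]. *)
rewrite !fpsDE !fps0E; under [X in _ + X _ _]eq_bigr do rewrite mulrDl.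
rewrite big_split /= !fpsDE !chain_gen_mul_coef => key.
rewrite -[RHS]key /sum_formula.
rewrite (sum_antidiag2 n m (fun r k r' k' => (-1) ^+ (r' + k') * l1 ^+ r * l2 ^+ r'
  * u1 ^+ k * u2 ^+ k' * phi (\sum_(a <- Senum r k) \sum_(b <- Senum r' k')
       (sgn b)%:~R * zeta_mod (a ++ b) p))).
rewrite (sum_antidiag2 n m (fun r k r' k' => (l1 ^+ r * u1 ^+ k + l2 ^+ r * u2 ^+ k)
  * (l1 + l2) ^+ r' * (u1 + u2) ^+ k' * phi (\sum_(a <- Senum r k)
     \sum_(b <- Senum r' k') zeta_mod (a ++ b) p))).
rewrite -!big_split; apply: eq_bigr => i _ /=.
rewrite -!big_split; apply: eq_bigr => j _ /=.
have -> : \sum_(a <- Senum i j) \sum_(b <- Senum (n - i) (m - j))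
    \sum_(0 <= y < sval p) \sum_(0 <= x < sval p)
      chain_sum (sval p) (@term (sval p)) a 0 y
      * chain_sum (sval p) (@sgn_term (sval p)) b y x =
    \sum_(a <- Senum i j) \sum_(b <- Senum (n - i) (m - j))
      (sgn b)%:~R * zeta_mod (a ++ b) p.
  apply: eq_bigr => a _; apply: eq_bigr => b _; rewrite zeta_mod_cat mulr_sumr.
  apply: eq_bigr => y _; rewrite mulr_sumr; apply: eq_bigr => x _.
  by rewrite chain_sum_sgn_term mulrCA.
have <- : \sum_(a <- Senum i j) \sum_(b <- Senum (n - i) (m - j)) zeta_mod (a ++ b) p =
    \sum_(a <- Senum i j) \sum_(b <- Senum (n - i) (m - j))
    \sum_(0 <= y < sval p) \sum_(0 <= x < sval p)
      chain_sum (sval p) (@term (sval p)) a 0 y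
      * chain_sum (sval p) (@term (sval p)) b y x.
  by apply: eq_bigr => a _; apply: eq_bigr => b _; rewrite zeta_mod_cat.
(* The arguments [- l2] and [- u2] supply the sign (-1)^(r_2 + k_2). *)
rewrite (exprNn l2) (exprNn u2) exprD; ring.
Qed.
End ModPFormula.

(** * Vanishing at odd primes and in the quotient *)

HB.instance Definition _ := GRing.RMorphism.copy toA (\pi_{ideal_quot sumFp})%qT.

Lemma toA_eq0 f : sumFp f -> toA f = 0.
Proof.
move=> hf; apply/eqP; rewrite -(rmorph0 toA) -Quotient.idealrBE subr0; exact: hf.
Qed.

Definition component (p : primeT) (f : prodFp) : 'F_(sval p) := f p.

Lemma component_zmod_morphism p : zmod_morphism (@component p).
Proof. by []. Qed.

Lemma component_monoid_morphism p : monoid_morphism (@component p).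
Proof. by []. Qed.

HB.instance Definition _ p :=
  GRing.isZmodMorphism.Build _ _ (@component p) (@component_zmod_morphism p).
HB.instance Definition _ p :=
  GRing.isMonoidMorphism.Build _ _ (@component p) (@component_monoid_morphism p).


Definition zeta_sum r k r' k' : prodFp :=
  \sum_(a <- Senum r k) \sum_(b <- Senum r' k') zeta_mod (a ++ b).
Definition sgn_zeta_sum r k r' k' : prodFp :=
  \sum_(a <- Senum r k) \sum_(b <- Senum r' k') (sgn b)%:~R * zeta_mod (a ++ b).

(** A lift of the identity to the full product, where it can be tested prime by prime. *)
Definition prodFp_formula n m : {mpoly prodFp[4]} :=
  sum_formula 'X_(@Ordinal 4 0 isT) 'X_(@Ordinal 4 1 isT)
    'X_(@Ordinal 4 2 isT) 'X_(@Ordinal 4 3 isT)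
    (fun r k r' k' => (sgn_zeta_sum r k r' k')%:MP)
    (fun r k r' k' => (zeta_sum r k r' k')%:MP) n m.

Lemma prodFp_formula_odd n m (p : primeT) : odd (sval p) ->
  map_mpoly (@component p) (prodFp_formula n m) = 0.
Proof.
move=> odd_p; rewrite rmorph_sum_formula /= !map_mpolyX.
rewrite -[RHS](@sum_formula_modp p {mpoly 'F_(sval p)[4]} (@mpolyC 4 'F_(sval p))
  'X_(@Ordinal 4 0 isT) 'X_(@Ordinal 4 1 isT) 'X_(@Ordinal 4 2 isT)
  'X_(@Ordinal 4 3 isT) n m odd_p).
apply: eq_sum_formula => r k r' k'; rewrite /= map_mpolyC;
  rewrite ?/sgn_zeta_sum ?/zeta_sum; congr (_%:MP);
  rewrite /= rmorph_sum; apply: eq_bigr => a _;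
  rewrite rmorph_sum; apply: eq_bigr => b _ //.
by rewrite rmorphM rmorph_int.
Qed.

(** Each coefficient has a possibly nonzero component only at the prime 2, hence lies in the
    ideal. *)
Lemma prodFp_formula_toA n m : map_mpoly toA (prodFp_formula n m) = 0.
Proof.
apply/mpolyP => mon; rewrite mcoeff_map_mpoly mcoeff0; apply: toA_eq0.
apply/asboolP; apply: (@sub_finite_set _ _ [set (exist prime 2 isT : primeT)]%classic).
  move=> p /= hp; apply: contrapT => p2; apply: hp.
  have odd_p : odd (sval p).
    case: (even_prime (svalP p)) => // e; case: p2; exact: val_inj.
  rewrite -[LHS]/(component p _) -mcoeff_map_mpoly prodFp_formula_odd //.
  exact: mcoeff0.
exact: finite_set1.
Qed.

Theorem mainTheorem1 (n m : nat) :
  \sum_(r : 'I_n.+1 * 'I_n.+1 | (r.1 + r.2 == n)%N)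
    \sum_(k : 'I_m.+1 * 'I_m.+1 | (k.1 + k.2 == m)%N)
      (-1) ^+ (r.2 + k.2)
      * lam1 ^+ r.1 * lam2 ^+ r.2 * mu1 ^+ k.1 * mu2 ^+ k.2
      * (\sum_(a \in Ssgn r.1 k.1) \sum_(b \in Ssgn r.2 k.2)
           (sgn b)%:~R * zetaA (a ++ b))%:MP
  + \sum_(r : 'I_n.+1 * 'I_n.+1 | (r.1 + r.2 == n)%N)
    \sum_(k : 'I_m.+1 * 'I_m.+1 | (k.1 + k.2 == m)%N)
      (lam1 ^+ r.1 * mu1 ^+ k.1 + lam2 ^+ r.1 * mu2 ^+ k.1)
      * (lam1 + lam2) ^+ r.2 * (mu1 + mu2) ^+ k.2
      * (\sum_(a \in Ssgn r.1 k.1) \sum_(b \in Ssgn r.2 k.2)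
           zetaA (a ++ b))%:MP
  = 0 :> {mpoly scrA[4]}.
Proof.
rewrite -[RHS](prodFp_formula_toA n m) rmorph_sum_formula /= !map_mpolyX.
(* It remains to match coefficients: the sums over [Ssgn] become sums over the lists [Senum],
   through which [toA] passes. *)
apply: (@eq_sum_formula _ lam1 lam2 mu1 mu2
  (fun r k r' k' => (\sum_(a \in Ssgn r k) \sum_(b \in Ssgn r' k')
      (sgn b)%:~R * zetaA (a ++ b))%:MP) _
  (fun r k r' k' => (\sum_(a \in Ssgn r k) \sum_(b \in Ssgn r' k')
      zetaA (a ++ b))%:MP)) => r k r' k'; rewrite /= map_mpolyC;
  rewrite ?/sgn_zeta_sum ?/zeta_sum; congr (_%:MP).
  rewrite (fsbig_Ssgn _ _ (fun a => \sum_(b \in Ssgn r' k')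
    (sgn b)%:~R * zetaA (a ++ b))).
  rewrite /= rmorph_sum; apply: eq_bigr => a _.
  rewrite (fsbig_Ssgn _ _ (fun b => (sgn b)%:~R * zetaA (a ++ b))).
  by rewrite rmorph_sum; apply: eq_bigr => b _; rewrite rmorphM rmorph_int.
rewrite (fsbig_Ssgn _ _ (fun a => \sum_(b \in Ssgn r' k') zetaA (a ++ b))).
rewrite /= rmorph_sum; apply: eq_bigr => a _.
rewrite (fsbig_Ssgn _ _ (fun b => zetaA (a ++ b))).
by rewrite rmorph_sum.
Qed.
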